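(* Let $n\ge 1$ and $k\ge 1$ be integers, and let $\mathbf{G}$ be an $n\times n$ real positive definite matrix which is $DP^k$ decomposable, i.e. $\mathbf{G}=\mathbf{D}-\mathbf{V}\mathbf{V}^T$ where $\mathbf{D}$ is an $n\times n$ real diagonal matrix and $\mathbf{V}$ is an $n\times k$ real matrix with linearly independent columns. Let $\mathbf{a}^*$ be a minimizer of $f(\mathbf{a})=\mathbf{a}^T\mathbf{G}\mathbf{a}$ over $\mathbf{a}\in\mathbb{Z}^n\setminus\{\mathbf{0}\}$. Then both of the following hold: (a) Either there exists a vector $\mathbf{x}\in\mathbb{R}^k$ such that $$\mathbf{a}^*-\tfrac12\mathbf{1}<\mathbf{D}^{-1}\mathbf{V}\mathbf{x}<\mathbf{a}^*+\tfrac12\mathbf{1}$$ (componentwise), and consequently $\mathbf{a}^*$ is the integer vector obtained by rounding each coordinate of $\mathbf{D}^{-1}\mathbf{V}\mathbf{x}$ to its nearest integer; or $\mathbf{a}^*=\pm\mathbf{e}_j$ for some standard unit vector $\mathbf{e}_j$. (b) $\|\mathbf{a}^*\|\le\sqrt{G_{min}/\lambda_{min}}$, where $G_{min}$ is the smallest diagonal entry of $\mathbf{G}$ and $\lambda_{min}$ is the smallest eigenvalue of $\mathbf{G}$.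
   Context: Vector inequalities are componentwise; $\mathbf{1}$ denotes the all-ones vector in $\mathbb{R}^n$ and $\|\cdot\|$ the Euclidean norm. Since $\mathbf{G}$ is positive definite and $\mathbf{V}\mathbf{V}^T$ is positive semidefinite, all diagonal entries of $\mathbf{D}$ are strictly positive, so $\mathbf{D}^{-1}$ exists. *)

(* Defs.v *)
From HB Require Import structures.
From mathcomp Require Import all_boot all_order all_algebra.
From mathcomp Require Import reals.

Set Implicit Arguments.
Unset Strict Implicit.
Unset Printing Implicit Defensive.

Import Order.TTheory GRing.Theory Num.Theory.
Local Open Scope ring_scope.

Definition qform (R : realType) (n : nat) (G : 'M[R]_n) (x : 'cV[R]_n) : R :=
  (x^T *m G *m x) 0 0.

Definition posdef (R : realType) (n : nat) (G : 'M[R]_n) : Prop :=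
  G^T = G /\ forall x : 'cV[R]_n, x != 0 -> 0 < qform G x.

(* [row_free V^T] is linear independence of the columns of [V]. *)
Definition DP_decomposition (R : realType) (n k : nat)
    (G D : 'M[R]_n) (V : 'M[R]_(n, k)) : Prop :=
  [/\ is_diag_mx D, row_free V^T & G = D - V *m V^T].

Definition intvec (R : realType) (n : nat) (a : 'cV[int]_n) : 'cV[R]_n :=
  map_mx intr a.

Definition shortest_int (R : realType) (n : nat) (G : 'M[R]_n)
    (a : 'cV[int]_n) : Prop :=
  a != 0 /\
  forall b : 'cV[int]_n, b != 0 -> qform G (intvec R a) <= qform G (intvec R b).

(* The inequality is strict, so [m] is the only nearest integer to [y]. *)
Definition nearest_int (R : realType) (y : R) (m : int) : Prop :=
  forall m' : int, m' != m -> `|y - m%:~R| < `|y - m'%:~R|.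

(* The norm that MathComp-Analysis puts on matrices is the sup norm. *)
Definition enorm (R : realType) (n : nat) (x : 'cV[R]_n) : R :=
  Num.sqrt (\sum_i x i 0 ^+ 2).

Definition smallest (R : realType) (P : R -> Prop) (m : R) : Prop :=
  P m /\ forall y, P y -> m <= y.

Definition diag_entry (R : realType) (n : nat) (G : 'M[R]_n) (y : R) : Prop :=
  exists i, y = G i i.

(* Main.v *)
From mathcomp Require Import all_boot all_order all_algebra.
From mathcomp Require Import complex reals.
From mathcomp Require Import ring lra.
Require Import Defs.

(** Minimality of [a] against [a + e_i] and [a - e_i], which are nonzero unless
    [a] is a signed unit vector, gives [2 |(G a)_i| <= G_ii]. For [x = V^T a]
    the rounding error is [D^-1 V x - a = - D^-1 G a], so its [i]-th entry is at
    most [G_ii / (2 D_ii)] in absolute value, and [D_ii = G_ii + |V_i|^2] where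
    [V_i] is the [i]-th row of [V].

    The norm bound is the Rayleigh inequality
    [lambda_min |a|^2 <= a^T G a <= G_jj] for a [j] minimizing [G_jj]. *)

Set Implicit Arguments.
Unset Strict Implicit.
Unset Printing Implicit Defensive.

Import Order.TTheory GRing.Theory Num.Theory.
Local Open Scope ring_scope.

Lemma delta_mx_neq0 (R : nzRingType) (m n : nat) (i : 'I_m) (j : 'I_n) :
  delta_mx i j != 0 :> 'M[R]_(m, n).
Proof. by apply/eqP => /matrixP/(_ i j)/eqP; rewrite !mxE !eqxx oner_eq0. Qed.

Section HermitianMatrix.
Variables (C : numClosedFieldType) (n : nat).
Implicit Types (A : 'M[C]_n) (d u v : 'rV[C]_n).

Lemma dotmx_mulr_unitary p (P : 'M[C]_(n, p)) u v :
  P \is unitarymx -> dotmx (u *m P) (v *m P) = dotmx u v.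
Proof.
by move=> unitaryP; rewrite !dotmxE trmx_mul map_mxM mulmxA mulmxtVK.
Qed.

Lemma dotmx_mulr_diag d u :
  dotmx (u *m diag_mx d) u = \sum_i d 0 i * `|u 0 i| ^+ 2.
Proof.
rewrite dotmxE mxE; apply: eq_bigr => i _.
by rewrite mul_mx_diag !mxE normCK mulrA [d 0 i * _]mulrC.
Qed.

Lemma eigenvalue_spectral_diag A i :
  A \is normalmx -> eigenvalue A (spectral_diag A 0 i).
Proof.
move=> /orthomx_spectralP defA; apply/eigenvalueP.
exists (row i (spectralmx A)); last first.
  rewrite rowE mulmx_free_eq0 ?row_free_unit ?spectral_unit //.
  exact: delta_mx_neq0.
rewrite -row_mul {2}defA mulmxA mulKVmx ?spectral_unit //.
by rewrite row_mul row_diag_mx -scalemxAl -rowE.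
Qed.

Lemma hermitian_eigenvalue_le_rayleigh A : (0 < n)%N -> A \is hermsymmx ->
  exists l, [/\ l \is Num.real, eigenvalue A l &
                forall u, l * dotmx u u <= dotmx (u *m A) u].
Proof.
move=> n_gt0 Aherm; have normA := hermitian_normalmx Aherm.
have /mxOverP d_real := hermitian_spectral_diag_real Aherm.
pose d := spectral_diag A; pose P := spectralmx A.
have [j _ jmin] := real_arg_minP (F := d 0) (isT : xpredT (Ordinal n_gt0))
  (fun i _ => d_real 0 i).
exists (d 0 j); split; rewrite ?eigenvalue_spectral_diag // => u.
have -> : u = u *m invmx P *m P by rewrite mulmxKV ?spectral_unit.
move: (u *m invmx P) => w.
have -> : w *m P *m A = w *m diag_mx d *m P.
  by rewrite {1}(orthomx_spectralP normA) !mulmxA mulmxK ?spectral_unit.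
rewrite !dotmx_mulr_unitary ?spectral_unitarymx //.
have -> : d 0 j * dotmx w w = dotmx (w *m diag_mx (const_mx (d 0 j))) w.
  by rewrite diag_const_mx mul_mx_scalar !dotmxE -scalemxAl [RHS]mxE.
rewrite !dotmx_mulr_diag; apply: ler_sum => i _.
by rewrite mxE ler_wpM2r ?exprn_ge0 ?jmin.
Qed.

End HermitianMatrix.

Section EuclideanNorm.
Variables (R : realType) (n : nat).
Implicit Types x : 'cV[R]_n.

Lemma enorm_ge0 x : 0 <= enorm x.
Proof. exact: sqrtr_ge0. Qed.

Lemma sqr_enormE x : enorm x ^+ 2 = (x^T *m x) 0 0.
Proof.
rewrite sqr_sqrtr; last by apply: sumr_ge0 => i _; apply: sqr_ge0.
by rewrite mxE; apply: eq_bigr => i _; rewrite mxE expr2.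
Qed.

Lemma enorm_gt0 x : (0 < enorm x) = (x != 0).
Proof.
rewrite lt0r enorm_ge0 andbT -sqrf_eq0 sqr_enormE; congr (~~ _).
apply/eqP/eqP => [|->]; last by rewrite mulmx0 mxE.
rewrite mxE => /psumr_eq0P sum0; apply/colP => i; apply/eqP.
rewrite mxE -sqrf_eq0 expr2 -{1}[x]trmxK mxE sum0 // => j _.
by rewrite mxE -expr2 sqr_ge0.
Qed.

End EuclideanNorm.

Section QuadraticForm.
Local Open Scope complex_scope.
Variables (R : realType) (n : nat) (G : 'M[R]_n).
Implicit Types x y : 'cV[R]_n.

Lemma qform_delta i : qform G (delta_mx i 0) = G i i.
Proof. by rewrite /qform trmx_delta -rowE -colE !mxE. Qed.

Lemma qformN x : qform G (- x) = qform G x.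
Proof. by rewrite /qform [(- x)^T]linearN /= mulmxN !mulNmx opprK. Qed.

Lemma posdef_diag_gt0 i : posdef G -> 0 < G i i.
Proof. by case=> _ posG; rewrite -qform_delta posG ?delta_mx_neq0. Qed.

Lemma eigenvalue_qform l : eigenvalue G l ->
  exists2 x, x != 0 & qform G x = l * enorm x ^+ 2.
Proof.
case/eigenvalueP=> v vG v_neq0; exists v^T; first by rewrite trmx_eq0.
by rewrite sqr_enormE /qform trmxK vG -scalemxAl mxE.
Qed.

Lemma posdef_eigenvalue_gt0 l : posdef G -> eigenvalue G l -> 0 < l.
Proof.
move=> [_ posG] /eigenvalue_qform[x x_neq0 qGx].
by rewrite -(@pmulr_lgt0 _ (enorm x ^+ 2)) ?exprn_gt0 ?enorm_gt0 // -qGx posG.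
Qed.

Hypothesis symG : G^T = G.

Lemma qformD x y :
  qform G (x + y) = qform G x + 2 * (y^T *m G *m x) 0 0 + qform G y.
Proof.
have dotC : (x^T *m G *m y) 0 0 = (y^T *m G *m x) 0 0.
  by rewrite -[y^T *m G *m x]trmxK [RHS]mxE !trmx_mul trmxK symG mulmxA.
have entryD (A B : 'M[R]_1) : (A + B) 0 0 = A 0 0 + B 0 0 by rewrite mxE.
rewrite /qform [(x + y)^T]linearD /= !(mulmxDl, mulmxDr).
by rewrite !entryD dotC; ring.
Qed.

Lemma symmetric_eigenvalue_le_rayleigh : (0 < n)%N ->
  exists2 l, eigenvalue G l & forall x, l * enorm x ^+ 2 <= qform G x.
Proof.
move=> n_gt0; pose toC : {rmorphism R -> R[i]} := real_complex R.
have realC p q (B : 'M[R]_(p, q)) : map_mx toC B \is a realmx.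
  by apply/mxOverP => i j; rewrite mxE; apply/complex_realP; exists (B i j).
have Gherm : map_mx toC G \is hermsymmx.
  apply: realsym_hermsym (realC _ _ G).
  by rewrite is_hermitianmxE expr0 scale1r map_mx_id // map_trmx symG.
have [_ [/complex_realP[l ->] eigl l_le]] :=
  hermitian_eigenvalue_le_rayleigh n_gt0 Gherm.
exists l; first by rewrite -(eigenvalue_map toC).
move=> x; have := l_le (map_mx toC x^T).
have toC_entry (B : 'M[R]_1) : map_mx toC B 0 0 = (B 0 0)%:C by rewrite mxE.
rewrite !dotmxE map_trmx trmxK realmxC ?realC // -!map_mxM !toC_entry.
by rewrite -(rmorphM toC) lecR -sqr_enormE.
Qed.

Lemma symmetric_smallest_eigenvalue : (0 < n)%N ->
  exists2 l, smallest (fun l => eigenvalue G l) l &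
             forall x, l * enorm x ^+ 2 <= qform G x.
Proof.
move=> /symmetric_eigenvalue_le_rayleigh[l eigl l_le].
exists l => //; split=> // m; case/eigenvalue_qform=> x x_neq0 qGx.
by have := l_le x; rewrite qGx ler_pM2r // exprn_gt0 ?enorm_gt0.
Qed.

End QuadraticForm.

Lemma smallest_diag_entry (R : realType) (n : nat) (G : 'M[R]_n) :
  (0 < n)%N -> exists i, smallest (diag_entry G) (G i i).
Proof.
move=> n_gt0.
have [i _ imin] := arg_minP (fun i => G i i) (isT : xpredT (Ordinal n_gt0)).
by exists i; split=> [|_ [j ->]]; [exists i | apply: imin].
Qed.

Section IntegerVector.
Variables (R : realType) (n : nat).
Implicit Types a b : 'cV[int]_n.

Lemma intvec_delta i : intvec R (delta_mx i 0) = delta_mx i 0 :> 'cV_n.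
Proof. exact: map_delta_mx. Qed.

Lemma intvecD a b : intvec R (a + b) = intvec R a + intvec R b.
Proof. exact: map_mxD. Qed.

Lemma intvecN a : intvec R (- a) = - intvec R a.
Proof. exact: map_mxN. Qed.

End IntegerVector.

Section ShortestVector.
Variables (R : realType) (n : nat) (G : 'M[R]_n) (a : 'cV[int]_n).
Hypothesis shortest_a : shortest_int G a.

Lemma shortest_int_le_diag i : qform G (intvec R a) <= G i i.
Proof.
rewrite -qform_delta -intvec_delta.
by apply: shortest_a.2; apply: delta_mx_neq0.
Qed.

Lemma shortest_int_dot_le (b : 'cV[int]_n) :
    G^T = G -> a != b -> a != - b ->
  `|2 * ((intvec R b)^T *m G *m intvec R a) 0 0| <= qform G (intvec R b).
Proof.
move=> symG a_neqb a_neqNb.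
have le_add c : a + c != 0 -> 0 <=
    2 * ((intvec R c)^T *m G *m intvec R a) 0 0 + qform G (intvec R c).
  by move/shortest_a.2; rewrite intvecD (qformD symG) -addrA lerDl.
have := le_add b; rewrite addr_eq0 => /(_ a_neqNb) le_b.
have := le_add (- b); rewrite subr_eq0 => /(_ a_neqb).
rewrite intvecN qformN linearN /= !mulNmx mxE => le_Nb.
by rewrite ler_norml; apply/andP; split; lra.
Qed.

Lemma shortest_int_grad_le i :
    G^T = G -> a != delta_mx i 0 -> a != - delta_mx i 0 ->
  `|2 * (G *m intvec R a) i 0| <= G i i.
Proof.
move=> symG a_neqe a_neqNe; have := shortest_int_dot_le symG a_neqe a_neqNe.
by rewrite intvec_delta qform_delta trmx_delta -mulmxA -rowE mxE.
Qed.

End ShortestVector.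

Lemma nearest_int_lt_half (R : realType) (y : R) (m : int) :
  `|y - m%:~R| < 2^-1 -> nearest_int y m.
Proof.
move=> ym m' m'_neqm.
have : 1 <= `|m%:~R - m'%:~R| :> R.
  rewrite -intrB -intr_norm (ler_int _ 1) -gtz0_ge1 normr_gt0 subr_eq0.
  by rewrite eq_sym.
have := ler_distD y m%:~R m'%:~R.
by rewrite (distrC m%:~R y); lra.
Qed.

Lemma intr_le_half_eq0 (R : realFieldType) (m : int) :
  `|m%:~R| <= 2^-1 :> R -> m = 0.
Proof.
move=> m_le; apply/eqP; rewrite -normr_le0 -ltzD1 -(ltr_int R) intr_norm.
by lra.
Qed.

Section DiagonalMatrix.
Variables (F : fieldType) (n : nat) (D : 'M[F]_n).
Hypotheses (diagD : is_diag_mx D) (D_neq0 : forall i, D i i != 0).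

Lemma diag_mx_unit : D \in unitmx.
Proof.
have [d defD] := diag_mxP _ diagD; rewrite defD unitmxE det_diag unitfE.
by apply/prodf_neq0 => i _; have := D_neq0 i; rewrite defD mxE eqxx.
Qed.

Lemma mul_invmx_diagE p (A : 'M[F]_(n, p)) i j :
  (invmx D *m A) i j = A i j / D i i.
Proof.
have [d defD] := diag_mxP _ diagD; rewrite -{2}[A](mulKVmx diag_mx_unit).
have Dii : D i i = d 0 i by rewrite defD mxE eqxx.
by rewrite {2}defD mul_diag_mx [in RHS]mxE -Dii mulrC mulKf.
Qed.

End DiagonalMatrix.

Section DPDecomposition.
Variables (R : realType) (n k : nat) (G D : 'M[R]_n) (V : 'M[R]_(n, k)).
Hypotheses (posG : posdef G) (decG : DP_decomposition G D V).

Lemma DP_diagE i : D i i = G i i + enorm (row i V)^T ^+ 2.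
Proof.
have [_ _ ->] := decG; rewrite sqr_enormE trmxK tr_row -row_mul.
by rewrite colE mulmxA -colE !mxE subrK.
Qed.

Lemma DP_diag_gt0 i : 0 < D i i.
Proof. by rewrite DP_diagE ltr_wpDr ?sqr_ge0 ?posdef_diag_gt0. Qed.

Lemma DP_diag_neq0 i : D i i != 0.
Proof. by rewrite lt0r_neq0 ?DP_diag_gt0. Qed.

Lemma DP_diag_le i : G i i <= D i i.
Proof. by rewrite DP_diagE lerDl sqr_ge0. Qed.

Lemma DP_diag_lt i : row i V != 0 -> G i i < D i i.
Proof. by move=> ?; rewrite DP_diagE ltrDl exprn_gt0 // enorm_gt0 trmx_eq0. Qed.

Definition DP_approx (z : 'cV[R]_n) : 'cV[R]_n :=
  invmx D *m V *m (V^T *m z).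

Lemma DP_approx_error z i :
  DP_approx z i 0 - z i 0 = - (G *m z) i 0 / D i i.
Proof.
have [diagD _ defG] := decG; have unitD := diag_mx_unit diagD DP_diag_neq0.
have -> : DP_approx z = z - invmx D *m (G *m z).
  rewrite /DP_approx defG mulmxBl mulmxBr mulKmx // opprB addrC.
  by rewrite subrK !mulmxA.
by rewrite mulNr -(mul_invmx_diagE diagD DP_diag_neq0) !mxE addrAC subrr add0r.
Qed.

Lemma DP_approx_row0 z i : row i V = 0 -> DP_approx z i 0 = 0.
Proof.
have [diagD _ _] := decG => Vi0.
rewrite /DP_approx -mulmxA (mul_invmx_diagE diagD DP_diag_neq0).
have /rowP/(_ 0) := row_mul i V (V^T *m z).
by rewrite Vi0 mul0mx !mxE => ->; rewrite mul0r.
Qed.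

Variable a : 'cV[int]_n.
Hypothesis shortest_a : shortest_int G a.

Section NonUnitCoordinate.
Variable i : 'I_n.
Hypotheses (a_neqe : a != delta_mx i 0) (a_neqNe : a != - delta_mx i 0).

Lemma DP_approx_error_le :
  `|DP_approx (intvec R a) i 0 - (a i 0)%:~R| <= 2^-1 * (G i i / D i i).
Proof.
have <- : intvec R a i 0 = (a i 0)%:~R by rewrite mxE.
have D_gt0 := DP_diag_gt0 i; have [symG _] := posG.
rewrite DP_approx_error mulNr normrN normrM normfV (gtr0_norm D_gt0).
rewrite mulrA ler_pM2r ?invr_gt0 // ler_pdivlMl //.
have := shortest_int_grad_le shortest_a symG a_neqe a_neqNe.
by rewrite normrM ger0_norm.
Qed.

(* The bound above is strict unless the [i]-th row of [V] vanishes, in which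
   case it reads [|a i 0| <= 1/2] and integrality takes over. *)
Lemma DP_approx_error_lt_half :
  `|DP_approx (intvec R a) i 0 - (a i 0)%:~R| < 2^-1.
Proof.
have D_gt0 := DP_diag_gt0 i; have error_le := DP_approx_error_le.
have [Vi0|Vi_neq0] := eqVneq (row i V) 0; last first.
  apply: le_lt_trans error_le _; rewrite gtr_pMr ?invr_gt0 //.
  by rewrite ltr_pdivrMr // mul1r DP_diag_lt.
move: error_le; rewrite DP_approx_row0 // sub0r normrN => a_le.
rewrite (@intr_le_half_eq0 R (a i 0)) ?normr0 ?invr_gt0 //.
apply: le_trans a_le _; rewrite ler_piMr ?invr_ge0 //.
by rewrite ler_pdivrMr // mul1r DP_diag_le.
Qed.

End NonUnitCoordinate.

End DPDecomposition.

Theorem theorem1 (R : realType) (n k : nat) (hn : (1 <= n)%N) (hk : (1 <= k)%N)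
    (G D : 'M[R]_n) (V : 'M[R]_(n, k))
    (hG : posdef G) (hDP : DP_decomposition G D V)
    (a : 'cV[int]_n) (ha : shortest_int G a) :
  ((exists x : 'cV[R]_k,
      let y : 'cV[R]_n := invmx D *m V *m x in
      (forall i : 'I_n,
         (a i 0)%:~R - 2^-1 < y i 0 /\ y i 0 < (a i 0)%:~R + 2^-1) /\
      (forall i : 'I_n, nearest_int (y i 0) (a i 0)))
   \/
   (exists j : 'I_n, a = delta_mx j 0 \/ a = - delta_mx j 0))
  /\
  (exists Gmin lmin : R,
     [/\ smallest (diag_entry G) Gmin,
         smallest (fun l : R => eigenvalue G l) lmin &
         enorm (intvec R a) <= Num.sqrt (Gmin / lmin)]).
Proof.
have [symG _] := hG; split.
  case: (boolP [exists j, (a == delta_mx j 0) || (a == - delta_mx j 0)]).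
    by case/existsP=> j /orP[]/eqP ->; right; exists j; [left | right].
  move=> /existsPn not_unit; left; exists (V^T *m intvec R a) => y.
  have y_near i : `|y i 0 - (a i 0)%:~R| < 2^-1.
    have [a_neqe a_neqNe] := norP (not_unit i).
    exact: (DP_approx_error_lt_half hG hDP ha a_neqe a_neqNe).
  split=> i; last exact: nearest_int_lt_half.
  by have := y_near i; rewrite ltr_distl => /andP.
have [l lmin rayleigh] := symmetric_smallest_eigenvalue symG hn.
have [j jmin] := smallest_diag_entry G hn.
exists (G j j), l; split=> //.
rewrite -[enorm _]ger0_norm ?enorm_ge0 // -sqrtr_sqr ler_wsqrtr //.
rewrite ler_pdivlMr ?(posdef_eigenvalue_gt0 hG lmin.1) // mulrC.
exact: le_trans (rayleigh _) (shortest_int_le_diag ha j).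
Qed.
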